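(* Let $\sigma = \langle R_1,\dots,R_l\rangle$ be a finite relational vocabulary, and let $\mathbf{STRUCT}[\sigma]$ be the category of finite $\sigma$-structures and homomorphisms. There is a Quillen model structure $\mathbb{M}$ on $\mathbf{STRUCT}[\sigma]$ such that: (1) the homotopy equivalences in $\mathbb{M}$ coincide with the homomorphic equivalences in $\mathbf{STRUCT}[\sigma]$; and (2) for every $k \in \mathbb{N}$ and all finite $\sigma$-structures $\mathfrak{A}, \mathfrak{B}$, we have $\mathfrak{A} \sim_k \mathfrak{B}$ if and only if $\mathfrak{A}$ and $\mathfrak{B}$ satisfy the same primitive-positive first-order $\sigma$-sentences of quantifier rank up to $k$.
   Context: A $\sigma$-structure $\mathfrak{A}$ consists of a finite (possibly empty) universe $A$ and an interpretation $R_i^{\mathfrak{A}} \subseteq A^{p_i}$ of each $p_i$-ary relation symbol $R_i$. A homomorphism $\mathfrak{A}\to\mathfrak{B}$ is a map $A \to B$ preserving all relations. The category $\mathbf{STRUCT}[\sigma]$ has finite limits and finite colimits. A Quillen model structure is meant in the sense requiring only finite limits and colimits, with classes of weak equivalences, fibrations and cofibrations satisfying two-out-of-three, closure under retracts, lifting and factorization; factorizations need not be functorial. A homotopy equivalence in $\mathbb{M}$ is a morphism $f:\mathfrak{A}\to\mathfrak{B}$ for which there is a morphism $g:\mathfrak{B}\to\mathfrak{A}$ such that $gf$ and $fg$ are homotopic, with respect to $\mathbb{M}$, to the respective identities (both left and right homotopic). A homomorphic equivalence is a homomorphism $f:\mathfrak{A}\to\mathfrak{B}$ such that there also exists some homomorphism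 $\mathfrak{B}\to\mathfrak{A}$. The Gaifman graph of $\mathfrak{A}$ has vertex set $A$, with distinct $a,b$ adjacent iff both occur in a common tuple of some $R_i^{\mathfrak{A}}$. The closure of a rooted forest is the graph on its nodes in which two distinct nodes are adjacent iff one is an ancestor of the other. The height of a rooted forest is the maximal number of nodes on a root-to-leaf path (so the empty forest has height $0$). The tree-depth of a finite graph is the minimal height of a finite rooted forest whose closure contains the graph as a subgraph, and the tree-depth of a finite structure is the tree-depth of its Gaifman graph. $\mathfrak{A}$ is $k$-homomorphic to $\mathfrak{B}$ if for every finite $\sigma$-structure $\mathfrak{C}$ of tree-depth at most $k$, the existence of a homomorphism $\mathfrak{C}\to\mathfrak{A}$ implies the existence of a homomorphism $\mathfrak{C}\to\mathfrak{B}$. The relation $\mathfrak{A}\sim_k\mathfrak{B}$ ($k$-homotopic equivalence) means that $\mathfrak{A}$ and $\mathfrak{B}$ are $k$-homomorphically equivalent, i.e. each is $k$-homomorphic to the other. A primitive-positive sentence is a first-order sentence built from atomic formulas (including equalities and the formula ''true'') using only conjunction and existential quantification. The quantifier rank of a formula is the maximal nesting depth of its quantifiers. *)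

(* Defs.v *)
From mathcomp Require Import all_boot.
From mathcomp Require Import boolp.

Set Implicit Arguments.
Unset Strict Implicit.
Unset Printing Implicit Defensive.

Record category := Category {
  obj :> Type;
  hom : obj -> obj -> Type;
  cid : forall X, hom X X;
  ccomp : forall X Y Z, hom Y Z -> hom X Y -> hom X Z;
  ccompA : forall X Y Z T (h : hom Z T) (g : hom Y Z) (f : hom X Y),
    ccomp h (ccomp g f) = ccomp (ccomp h g) f;
  ccomp1l : forall X Y (f : hom X Y), ccomp (cid Y) f = f;
  ccomp1r : forall X Y (f : hom X Y), ccomp f (cid X) = f
}.

Arguments cid {c} X.
Arguments ccomp {c X Y Z} g f.

Notation "g \oc f" := (ccomp g f) (at level 40, left associativity).

Record finCategory := FinCategory {
  fin_obj : finType;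
  fin_hom : fin_obj -> fin_obj -> finType;
  fin_id : forall X, fin_hom X X;
  fin_comp : forall X Y Z, fin_hom Y Z -> fin_hom X Y -> fin_hom X Z;
  fin_compA : forall X Y Z T
      (h : fin_hom Z T) (g : fin_hom Y Z) (f : fin_hom X Y),
    fin_comp h (fin_comp g f) = fin_comp (fin_comp h g) f;
  fin_comp1l : forall X Y (f : fin_hom X Y), fin_comp (fin_id Y) f = f;
  fin_comp1r : forall X Y (f : fin_hom X Y), fin_comp f (fin_id X) = f
}.

Definition category_of_fin (J : finCategory) : category :=
  @Category (fin_obj J) (fun i j => fin_hom i j)
    (@fin_id J) (@fin_comp J) (@fin_compA J) (@fin_comp1l J) (@fin_comp1r J).

Coercion category_of_fin : finCategory >-> category.

Record functor (J C : category) := Functor {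
  fobj :> J -> C;
  fmap : forall i j, hom i j -> hom (fobj i) (fobj j);
  fmap_id : forall i, fmap (cid i) = cid (fobj i);
  fmap_comp : forall i j l (g : hom j l) (f : hom i j),
    fmap (g \oc f) = fmap g \oc fmap f
}.

Section Limits.
Variables (J C : category) (D : functor J C).

Definition is_cone (L : C) (p : forall j, hom L (D j)) : Prop :=
  forall i j (f : hom i j), fmap D f \oc p i = p j.

Definition is_limit (L : C) (p : forall j, hom L (D j)) : Prop :=
  is_cone p /\
  forall (X : C) (q : forall j, hom X (D j)), is_cone q ->
    exists! u : hom X L, forall j, p j \oc u = q j.

Definition is_cocone (L : C) (p : forall j, hom (D j) L) : Prop :=
  forall i j (f : hom i j), p j \oc fmap D f = p i.

Definition is_colimit (L : C) (p : forall j, hom (D j) L) : Prop :=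
  is_cocone p /\
  forall (X : C) (q : forall j, hom (D j) X), is_cocone q ->
    exists! u : hom L X, forall j, u \oc p j = q j.

End Limits.

Definition has_finite_limits (C : category) : Prop :=
  forall (J : finCategory) (D : functor J C),
    exists (L : C) (p : forall j : J, hom L (D j)), is_limit p.

Definition has_finite_colimits (C : category) : Prop :=
  forall (J : finCategory) (D : functor J C),
    exists (L : C) (p : forall j : J, hom (D j) L), is_colimit p.

Definition is_product (C : category) (X Y P : C)
    (p1 : hom P X) (p2 : hom P Y) : Prop :=
  forall (Z : C) (f : hom Z X) (g : hom Z Y),
    exists! u : hom Z P, p1 \oc u = f /\ p2 \oc u = g.

Definition is_coproduct (C : category) (X Y S : C)
    (i1 : hom X S) (i2 : hom Y S) : Prop :=
  forall (Z : C) (f : hom X Z) (g : hom Y Z),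
    exists! u : hom S Z, u \oc i1 = f /\ u \oc i2 = g.

Definition mor_class (C : category) := forall X Y : C, hom X Y -> Prop.

Definition mor_cap (C : category) (P Q : mor_class C) : mor_class C :=
  fun X Y f => P X Y f /\ Q X Y f.

Definition two_of_three (C : category) (W : mor_class C) : Prop :=
  forall (X Y Z : C) (f : hom X Y) (g : hom Y Z),
    [/\ W _ _ f -> W _ _ g -> W _ _ (g \oc f),
        W _ _ f -> W _ _ (g \oc f) -> W _ _ g
      & W _ _ g -> W _ _ (g \oc f) -> W _ _ f].

Definition is_retract (C : category) (A B X Y : C)
    (f : hom A B) (g : hom X Y) : Prop :=
  exists (i : hom A X) (r : hom X A) (i' : hom B Y) (r' : hom Y B),
    [/\ r \oc i = cid A, r' \oc i' = cid B,
        g \oc i = i' \oc f & f \oc r = r' \oc g].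

Definition retract_closed (C : category) (P : mor_class C) : Prop :=
  forall (A B X Y : C) (f : hom A B) (g : hom X Y),
    is_retract f g -> P _ _ g -> P _ _ f.

Definition has_lift (C : category) (A B X Y : C)
    (i : hom A B) (p : hom X Y) : Prop :=
  forall (u : hom A X) (v : hom B Y), p \oc u = v \oc i ->
    exists h : hom B X, h \oc i = u /\ p \oc h = v.

Definition lifting (C : category) (L R : mor_class C) : Prop :=
  forall (A B X Y : C) (i : hom A B) (p : hom X Y),
    L _ _ i -> R _ _ p -> has_lift i p.

Definition factorization (C : category) (L R : mor_class C) : Prop :=
  forall (X Y : C) (f : hom X Y),
    exists (Z : C) (i : hom X Z) (p : hom Z Y),
      [/\ L _ _ i, R _ _ p & p \oc i = f].

Record model_structure (C : category) := ModelStructure {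
  weq : mor_class C;
  fib : mor_class C;
  cof : mor_class C;
  ms_limits : has_finite_limits C;
  ms_colimits : has_finite_colimits C;
  ms_two_of_three : two_of_three weq;
  ms_retract_weq : retract_closed weq;
  ms_retract_fib : retract_closed fib;
  ms_retract_cof : retract_closed cof;
  ms_lift_acof_fib : lifting (mor_cap cof weq) fib;
  ms_lift_cof_afib : lifting cof (mor_cap fib weq);
  ms_fact_acof_fib : factorization (mor_cap cof weq) fib;
  ms_fact_cof_afib : factorization cof (mor_cap fib weq)
}.

Section Homotopy.
Variables (C : category) (M : model_structure C).

(* [Cyl] is a cylinder object: the fold map of [A] factors through it as a
   cofibration [j] followed by a weak equivalence [s]. *)
Definition left_homotopic (A B : C) (f g : hom A B) : Prop :=
  exists (S : C) (i1 i2 : hom A S) (Cyl : C) (j : hom S Cyl) (s : hom Cyl A)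
         (H : hom Cyl B),
    [/\ is_coproduct i1 i2, cof M j /\ weq M s,
        s \oc (j \oc i1) = cid A /\ s \oc (j \oc i2) = cid A
      & H \oc (j \oc i1) = f /\ H \oc (j \oc i2) = g].

(* [Pth] is a path object: the diagonal of [B] factors through it as a weak
   equivalence [s] followed by a fibration [q]. *)
Definition right_homotopic (A B : C) (f g : hom A B) : Prop :=
  exists (P : C) (p1 p2 : hom P B) (Pth : C) (q : hom Pth P) (s : hom B Pth)
         (H : hom A Pth),
    [/\ is_product p1 p2, fib M q /\ weq M s,
        (p1 \oc q) \oc s = cid B /\ (p2 \oc q) \oc s = cid B
      & (p1 \oc q) \oc H = f /\ (p2 \oc q) \oc H = g].

Definition homotopic (A B : C) (f g : hom A B) : Prop :=
  left_homotopic f g /\ right_homotopic f g.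

Definition homotopy_equivalence (A B : C) (f : hom A B) : Prop :=
  exists g : hom B A,
    homotopic (g \oc f) (cid A) /\ homotopic (f \oc g) (cid B).

End Homotopy.

(* Nullary relation symbols are allowed. *)
Record vocabulary := Vocabulary {
  nsym : nat;
  arity : 'I_nsym -> nat
}.

Record structure (sigma : vocabulary) := Structure {
  univ :> finType;
  interp : forall i : 'I_(nsym sigma), {set (arity i).-tuple univ}
}.

Section Structures.
Variable sigma : vocabulary.
Implicit Types A B C : structure sigma.

Definition is_hom A B (h : {ffun A -> B}) : bool :=
  [forall i, forall t in interp A i, map_tuple h t \in interp B i].

Definition homomorphism A B := {h : {ffun A -> B} | is_hom h}.

Lemma is_homP A B (h : {ffun A -> B}) :
  reflect (forall i t, t \in interp A i -> map_tuple h t \in interp B i)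
          (is_hom h).
Proof.
apply: (iffP forallP) => [H i t|H i]; last first.
  by apply/forall_inP => t; apply: H.
by move=> tA; have /forall_inP/(_ t tA) := H i.
Qed.

Lemma id_is_hom A : is_hom [ffun x : A => x].
Proof.
apply/is_homP => i t tA; rewrite (_ : map_tuple _ t = t) //.
by apply: eq_from_tnth => j; rewrite tnth_map ffunE.
Qed.

Lemma comp_is_hom A B C (g : homomorphism B C) (f : homomorphism A B) :
  is_hom [ffun x => val g (val f x)].
Proof.
apply/is_homP => i t tA.
have /is_homP/(_ _ _ tA) tB := valP f.
have /is_homP/(_ _ _ tB) := valP g.
rewrite (_ : map_tuple _ (map_tuple _ t) =
             map_tuple [ffun x => val g (val f x)] t) //.
by apply: eq_from_tnth => j; rewrite !tnth_map ffunE.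
Qed.

Definition hom_id A : homomorphism A A :=
  exist (fun h => is_hom h) _ (id_is_hom A).

Definition hom_comp A B C (g : homomorphism B C) (f : homomorphism A B) :
  homomorphism A C :=
  exist (fun h => is_hom h) _ (comp_is_hom g f).

Lemma hom_compA A B C D (h : homomorphism C D) (g : homomorphism B C)
    (f : homomorphism A B) :
  hom_comp h (hom_comp g f) = hom_comp (hom_comp h g) f.
Proof. by apply: val_inj; apply/ffunP => x; rewrite /= !ffunE /= ?ffunE. Qed.

Lemma hom_comp1l A B (f : homomorphism A B) : hom_comp (hom_id B) f = f.
Proof. by apply: val_inj; apply/ffunP => x; rewrite /= !ffunE /= ?ffunE. Qed.

Lemma hom_comp1r A B (f : homomorphism A B) : hom_comp f (hom_id A) = f.
Proof. by apply: val_inj; apply/ffunP => x; rewrite /= !ffunE /= ?ffunE. Qed.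

Definition STRUCT : category :=
  @Category (structure sigma) homomorphism
    hom_id hom_comp hom_compA hom_comp1l hom_comp1r.

Definition homomorphic_equivalence A B (f : homomorphism A B) : Prop :=
  inhabited (homomorphism B A).

End Structures.

Record sgraph := SGraph {
  vertex :> finType;
  adj : rel vertex;
  adj_sym : symmetric adj;
  adj_irr : irreflexive adj
}.

Definition parent_rel (F : finType) (parent : F -> option F) : rel F :=
  fun x y => parent x == Some y.

(* For a finite parent map, reaching a root from every node is the same as
   having no cycle. *)
Record rforest := RForest {
  node :> finType;
  parent : node -> option node;
  rooted : forall x, exists2 r, connect (parent_rel parent) x r
                              & parent r = None
}.

Section Forest.
Variable F : rforest.

Definition ancestor_or_self (y x : F) : bool :=
  connect (parent_rel (@parent F)) x y.

Definition ancestor (y x : F) : bool := (y != x) && ancestor_or_self y x.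

Definition closure_adj (x y : F) : bool := ancestor x y || ancestor y x.

Definition leaf (x : F) : bool := [forall y : F, parent y != Some x].

(* The root-to-leaf path ending in the leaf [x] consists of [x] and its
   ancestors. *)
Definition height : nat :=
  \max_(x : F | leaf x) #|[set y : F | ancestor_or_self y x]|.

End Forest.

Definition closure_contains (F : rforest) (G : sgraph) : Prop :=
  exists f : G -> F,
    injective f /\ forall x y, adj x y -> closure_adj (f x) (f y).

Definition forest_height_for (G : sgraph) (d : nat) : Prop :=
  exists F : rforest, height F = d /\ closure_contains F G.

Section ChainForest.
Variable n : nat.

Definition chain_parent (x : 'I_n) : option 'I_n :=
  if val x is m.+1 then insub m else None.

Lemma chain_connect (x y : 'I_n) :
  y <= x -> connect (parent_rel chain_parent) x y.
Proof.
case: x => m; elim: m => [|m IHm] lt_mn /=.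
  rewrite leqn0 => /eqP y0.
  by rewrite (_ : y = Ordinal lt_mn) ?connect0 //; apply: val_inj.
rewrite leq_eqVlt => /orP[/eqP ym|].
  by rewrite (_ : y = Ordinal lt_mn) ?connect0 //; apply: val_inj.
rewrite ltnS => le_ym.
apply: connect_trans (IHm (ltnW lt_mn) le_ym); apply: connect1.
by rewrite /parent_rel /chain_parent /= (insubT (fun j => j < n) (ltnW lt_mn)).
Qed.

Lemma chain_rooted (x : 'I_n) :
  exists2 r, connect (parent_rel chain_parent) x r & chain_parent r = None.
Proof.
have n_gt0 : 0 < n by apply: leq_ltn_trans (ltn_ord x).
by exists (Ordinal n_gt0) => //; apply: chain_connect.
Qed.

Definition chain_forest : rforest := RForest chain_rooted.

End ChainForest.

Lemma forest_height_ex (G : sgraph) :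
  exists d, `[< forest_height_for G d >].
Proof.
exists (height (chain_forest #|G|)); apply/asboolP.
exists (chain_forest #|G|); split => //.
exists (fun x : G => enum_rank x); split; first exact: enum_rank_inj.
move=> x y xy; have neq_xy : enum_rank x != enum_rank y.
  by apply: contraTneq xy => /enum_rank_inj->; rewrite adj_irr.
rewrite /closure_adj /ancestor neq_xy eq_sym neq_xy /=.
case/orP: (leq_total (enum_rank x) (enum_rank y)) => le.
  by apply/orP; left; apply: chain_connect.
by apply/orP; right; apply: chain_connect.
Qed.

(* The predicate minimized is not boolean: it is made so by [`[< _ >]]. *)
Definition tree_depth (G : sgraph) : nat := ex_minn (forest_height_ex G).

Section Gaifman.
Variables (sigma : vocabulary) (A : structure sigma).

Definition gaifman_adj (a b : A) : bool :=
  (a != b) && [exists i, exists t in interp A i, (a \in t) && (b \in t)].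

Lemma gaifman_sym : symmetric gaifman_adj.
Proof.
move=> a b; rewrite /gaifman_adj eq_sym; congr (_ && _).
by apply: eq_existsb => i; apply: eq_existsb => t; rewrite [(a \in _) && _]andbC.
Qed.

Lemma gaifman_irr : irreflexive gaifman_adj.
Proof. by move=> a; rewrite /gaifman_adj eqxx. Qed.

Definition gaifman : sgraph := SGraph gaifman_sym gaifman_irr.

End Gaifman.

Definition structure_tree_depth (sigma : vocabulary) (A : structure sigma) :
  nat := tree_depth (gaifman A).

Definition k_homomorphic (sigma : vocabulary) (k : nat)
    (A B : structure sigma) : Prop :=
  forall C : structure sigma, structure_tree_depth C <= k ->
    inhabited (homomorphism C A) -> inhabited (homomorphism C B).

Definition k_homotopy_equivalent (sigma : vocabulary) (k : nat)
    (A B : structure sigma) : Prop :=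
  k_homomorphic k A B /\ k_homomorphic k B A.

(* [ppform sigma n] is the type of formulas with free variables among
   [x_0, ..., x_(n-1)]; [PPEx] binds variable 0 and shifts the others. *)
Inductive ppform (sigma : vocabulary) : nat -> Type :=
| PPTrue n : ppform sigma n
| PPEq n (x y : 'I_n) : ppform sigma n
| PPRel n (i : 'I_(nsym sigma)) (x : (arity i).-tuple 'I_n) : ppform sigma n
| PPAnd n (phi psi : ppform sigma n) : ppform sigma n
| PPEx n (phi : ppform sigma n.+1) : ppform sigma n.

Definition ppsentence (sigma : vocabulary) := ppform sigma 0.

Fixpoint qrank (sigma : vocabulary) n (phi : ppform sigma n) : nat :=
  match phi with
  | PPTrue _ | PPEq _ _ _ | PPRel _ _ _ => 0
  | PPAnd _ phi psi => maxn (qrank phi) (qrank psi)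
  | PPEx _ phi => (qrank phi).+1
  end.

Fixpoint sat (sigma : vocabulary) (A : structure sigma) n
    (phi : ppform sigma n) : n.-tuple A -> Prop :=
  match phi in ppform _ n return n.-tuple A -> Prop with
  | PPTrue _ => fun _ => True
  | PPEq _ x y => fun e => tnth e x = tnth e y
  | PPRel _ i x => fun e => map_tuple (tnth e) x \in interp A i
  | PPAnd _ phi psi => fun e => sat phi e /\ sat psi e
  | PPEx _ phi => fun e => exists a : A, sat phi (cons_tuple a e)
  end.

Definition models (sigma : vocabulary) (A : structure sigma)
    (phi : ppsentence sigma) : Prop := sat phi (nil_tuple A).

(* Main.v *)
From mathcomp Require Import all_boot.
From mathcomp Require Import boolp.
Require Import Defs.

Set Implicit Arguments.
Unset Strict Implicit.
Unset Printing Implicit Defensive.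

(* Model structure: in a category with finite limits and colimits, let the weak
   equivalences be the maps [X -> Y] admitting some map [Y -> X], the acyclic
   fibrations the split epimorphisms, and the fibrations the maps [X -> Y]
   through which every [B -> Y] with [Hom(B, X)] inhabited factors.  The two
   factorizations of [X -> Y] go through [X + Y] and [X + X * Y].  All parallel
   maps are then homotopic, with cylinder [A + A] and path object [B * B].

   Logic: let [U_k A] consist of the nonempty stacks of at most [k] elements of
   [A], with relations induced by the top elements of pairwise comparable
   stacks.  It has tree-depth at most [k], it maps to [A], and every structure
   of tree-depth at most [k] that maps to [A] maps to [U_k A].  A map
   [U_k A -> B] is a winning strategy for Duplicator in the [k]-round
   existential-positive game, so it exists iff [B] satisfies all
   primitive-positive sentences of rank at most [k] true in [A]. *)

(** * A model structure with the homomorphic equivalences as weak equivalences *)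

Section PreorderModelStructure.
Variable C : category.
Hypothesis limC : has_finite_limits C.
Hypothesis colimC : has_finite_colimits C.
Hypothesis prodC : forall X Y : C,
  exists (P : C) (p1 : hom P X) (p2 : hom P Y), is_product p1 p2.
Hypothesis coprodC : forall X Y : C,
  exists (S : C) (i1 : hom X S) (i2 : hom Y S), is_coproduct i1 i2.

Lemma coproduct_hom_ext (X Y S Z : C) (i1 : hom X S) (i2 : hom Y S)
    (u v : hom S Z) :
  is_coproduct i1 i2 -> u \oc i1 = v \oc i1 -> u \oc i2 = v \oc i2 -> u = v.
Proof.
move=> cop uv1 uv2; have [w [_ uniq_w]] := cop _ (v \oc i1) (v \oc i2).
by rewrite -(uniq_w u) // -(uniq_w v).
Qed.

Definition split_epi (X Y : C) (p : hom X Y) : Prop :=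
  exists s : hom Y X, p \oc s = cid Y.

Definition backward_hom : mor_class C :=
  fun X Y _ => inhabited (hom Y X).

(** Defining cofibrations by a lifting property makes one of the two lifting axioms immediate. *)
Definition split_epi_cof : mor_class C :=
  fun A B i => forall (X Y : C) (p : hom X Y), split_epi p -> has_lift i p.

Definition preorder_fib : mor_class C :=
  fun X Y p => forall (B : C) (b : hom B X) (v : hom B Y),
    exists w : hom B X, p \oc w = v.

Lemma backward_hom_two_of_three : two_of_three backward_hom.
Proof.
move=> X Y Z f g; split.
- by case=> f' [g']; exists; exact: (f' \oc g').
- by move=> _ [h]; exists; exact: (f \oc h).
- by move=> _ [h]; exists; exact: (h \oc g).
Qed.

Lemma backward_hom_retract : retract_closed backward_hom.
Proof.
by move=> A B X Y f g [i [r [i' [r' _]]]] [h]; exists; exact: (r \oc (h \oc i')).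
Qed.

Lemma preorder_fib_retract : retract_closed preorder_fib.
Proof.
move=> A B X Y f g [i [r [i' [r' [_ ri' _ fr]]]]] fib_g D b v.
have [w gw] := fib_g D (i \oc b) (i' \oc v).
by exists (r \oc w); rewrite ccompA fr -ccompA gw ccompA ri' ccomp1l.
Qed.

Lemma split_epi_cof_retract : retract_closed split_epi_cof.
Proof.
move=> A B X Y f g [i [r [i' [r' [ri ri' gi fr]]]]] cof_g E D p sp u v uv.
have [|h [hg ph]] := cof_g _ _ _ sp (u \oc r) (v \oc r').
  by rewrite ccompA uv -!ccompA fr.
exists (h \oc i'); split; last by rewrite ccompA ph -ccompA ri' ccomp1r.
by rewrite -ccompA -gi ccompA hg -ccompA ri ccomp1r.
Qed.

Lemma split_epi_acyclic_fib (X Y : C) (p : hom X Y) :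
  mor_cap preorder_fib backward_hom p <-> split_epi p.
Proof.
split=> [[fib_p [b]]|[s ps]]; first exact: (fib_p Y b (cid Y)).
split=> [B _ v|]; last by exists.
by exists (s \oc v); rewrite ccompA ps ccomp1l.
Qed.

(** The lift is forced on the first summand; on the second, the section of [p] supplies one. *)
Lemma coproduct_inl_cof (X Y S : C) (i1 : hom X S) (i2 : hom Y S) :
  is_coproduct i1 i2 -> split_epi_cof i1.
Proof.
move=> cop E D p [s ps] u v uv.
have [h [[h1 h2] _]] := cop _ u (s \oc (v \oc i2)).
exists h; split => //; apply: (coproduct_hom_ext cop); rewrite -ccompA ?h1 //.
by rewrite h2 ccompA ps ccomp1l.
Qed.

(** A cofibration [i : A -> B] is a retract of the injection of [A] into [A + B]: lift it against
    the split epimorphism from [A + B] to [B]. A map out of [A + B] can then be chosen on each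
    summand separately. *)
Lemma acyclic_cof_fib_lifting :
  lifting (mor_cap split_epi_cof backward_hom) preorder_fib.
Proof.
move=> A B X Y i p [cof_i [b]] fib_p u v uv.
have [S [i1 [i2 cop]]] := coprodC A B.
have [c [[c1 c2] _]] := cop _ i (cid B).
have c_split : split_epi c by exists i2.
have [|h [hi ch]] := cof_i _ _ c c_split i1 (cid B); first by rewrite c1 ccomp1l.
(* Here [u \oc b] only witnesses that [Hom(B, X)] is inhabited; [w \oc i] may differ from [u]. *)
have [w pw] := fib_p B (u \oc b) v.
have [k [[k1 k2] _]] := cop _ u w.
have pk : p \oc k = v \oc c.
  by apply: (coproduct_hom_ext cop); rewrite -!ccompA ?k1 ?k2 ?c1 // c2 ccomp1r.
exists (k \oc h); split; first by rewrite -ccompA hi k1.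
by rewrite ccompA pk -ccompA ch ccomp1r.
Qed.

Lemma cof_acyclic_fib_lifting :
  lifting split_epi_cof (mor_cap preorder_fib backward_hom).
Proof. by move=> A B X Y i p cof_i /split_epi_acyclic_fib; apply: cof_i. Qed.

Lemma acyclic_cof_fib_factorization :
  factorization (mor_cap split_epi_cof backward_hom) preorder_fib.
Proof.
move=> X Y f; have [P [p1 [p2 isP]]] := prodC X Y.
have [S [i1 [i2 cop]]] := coprodC X P.
have [r [_ _]] := cop _ (cid X) p1; have [q [[q1 q2] _]] := cop _ f p2.
exists S, i1, q; split=> //.
  by split; [exact: coproduct_inl_cof cop | exists].
(* The retraction [r] turns [b] into a map to [X], which pairs with [v] to land in the summand
   [P]. *)
move=> B b v; have [w [[_ w2] _]] := isP _ (r \oc b) v.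
by exists (i2 \oc w); rewrite ccompA q2.
Qed.

Lemma cof_acyclic_fib_factorization :
  factorization split_epi_cof (mor_cap preorder_fib backward_hom).
Proof.
move=> X Y f; have [S [i1 [i2 cop]]] := coprodC X Y.
have [q [[q1 q2] _]] := cop _ f (cid Y).
exists S, i1, q; split=> //; first exact: coproduct_inl_cof cop.
by apply/split_epi_acyclic_fib; exists i2.
Qed.

Definition preorder_model : model_structure C :=
  ModelStructure limC colimC backward_hom_two_of_three backward_hom_retract
    preorder_fib_retract split_epi_cof_retract acyclic_cof_fib_lifting
    cof_acyclic_fib_lifting acyclic_cof_fib_factorization
    cof_acyclic_fib_factorization.

(** With the coproduct itself as cylinder and the product itself as path object, homotopies are
    copairings and pairings, which exist for any [f] and [g]. *)
Lemma preorder_homotopic (A B : C) (f g : hom A B) :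
  homotopic preorder_model f g.
Proof.
split.
  have [S [i1 [i2 cop]]] := coprodC A A.
  have [s [[s1 s2] _]] := cop _ (cid A) (cid A).
  have [H [[H1 H2] _]] := cop _ f g.
  exists S, i1, i2, S, (cid S), s, H; rewrite !ccomp1l; split=> //.
  split; last by exists.
  by move=> E D p _ u v uv; exists u; rewrite ccomp1r uv ccomp1r.
have [P [p1 [p2 isP]]] := prodC B B.
have [s [[s1 s2] _]] := isP _ (cid B) (cid B).
have [H [[H1 H2] _]] := isP _ f g.
exists P, p1, p2, P, (cid P), s, H; rewrite !ccomp1r; split=> //.
by split; [move=> D _ v; exists v; rewrite ccomp1l | exists].
Qed.

Lemma preorder_homotopy_equivalence (A B : C) (f : hom A B) :
  homotopy_equivalence preorder_model f <-> inhabited (hom B A).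
Proof.
split=> [[g _]|[g]]; first by exists.
by exists g; split; apply: preorder_homotopic.
Qed.

End PreorderModelStructure.

(** * Finite limits and colimits of structures *)

Section FiniteLimits.
Variable sigma : vocabulary.

Lemma tuple_set_ext (T : finType) n (X : {set n.-tuple T}) (s t : n.-tuple T) :
  tnth s =1 tnth t -> s \in X -> t \in X.
Proof. by move=> /eq_from_tnth->. Qed.

Lemma hom_tuple (A B : structure sigma) (h : homomorphism A B) i t :
  t \in interp A i -> map_tuple (val h) t \in interp B i.
Proof. by have /is_homP := valP h; apply. Qed.

Lemma mk_hom (A B : structure sigma) (h : A -> B) :
  (forall i t, t \in interp A i -> map_tuple h t \in interp B i) ->
  {f : homomorphism A B | forall x, val f x = h x}.
Proof.
move=> hP.
have homh : is_hom [ffun x => h x].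
  apply/is_homP => i t /hP.
  by apply: tuple_set_ext => j; rewrite !tnth_map ffunE.
by exists (exist (fun h => is_hom h) _ homh) => x; rewrite /= ffunE.
Qed.

Lemma hom_ext (A B : structure sigma) (f g : homomorphism A B) :
  (forall x, val f x = val g x) -> f = g.
Proof. by move=> fg; apply/val_inj/ffunP. Qed.

Lemma hom_comp_ext (A B C : structure sigma) (g : homomorphism B C)
    (f : homomorphism A B) (h : homomorphism A C) :
  (forall x, val g (val f x) = val h x) <-> hom_comp g f = h.
Proof.
split=> [gf|<- x]; last by rewrite /= ffunE.
by apply: hom_ext => x; rewrite -gf /= ffunE.
Qed.

(** * Binary products and coproducts *)

Section Product.
Variables A B : structure sigma.

Definition prod_structure : structure sigma :=
  @Structure sigma (A * B)%type (fun i => [set t |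
    (map_tuple fst t \in interp A i) && (map_tuple snd t \in interp B i)]).

Lemma STRUCT_product : exists (P : STRUCT sigma) (p1 : @hom (STRUCT sigma) P A)
  (p2 : @hom (STRUCT sigma) P B), is_product p1 p2.
Proof.
have [i t|p1 p1E] := @mk_hom prod_structure A fst.
  by rewrite inE => /andP[].
have [i t|p2 p2E] := @mk_hom prod_structure B snd.
  by rewrite inE => /andP[].
exists prod_structure, p1, p2 => Z f g.
have [i t tZ|u uE] := @mk_hom Z prod_structure (fun z => (val f z, val g z)).
  rewrite inE; apply/andP; split.
    by apply: tuple_set_ext (hom_tuple f tZ) => j; rewrite !tnth_map.
  by apply: tuple_set_ext (hom_tuple g tZ) => j; rewrite !tnth_map.
exists u; split.
  by split; apply/hom_comp_ext => x; rewrite ?p1E ?p2E uE.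
move=> v [/hom_comp_ext v1 /hom_comp_ext v2]; apply: hom_ext => x.
by rewrite uE -v1 -v2 p1E p2E -surjective_pairing.
Qed.

End Product.

Section Coproduct.
Variables A B : structure sigma.

Definition sum_structure : structure sigma :=
  @Structure sigma (A + B)%type (fun i =>
    [set map_tuple inl t | t in interp A i] :|:
    [set map_tuple inr t | t in interp B i]).

Lemma STRUCT_coproduct :
  exists (S : STRUCT sigma) (i1 : @hom (STRUCT sigma) A S)
    (i2 : @hom (STRUCT sigma) B S), is_coproduct i1 i2.
Proof.
have [i t tA|i1 i1E] := @mk_hom A sum_structure inl.
  by rewrite inE imset_f.
have [i t tB|i2 i2E] := @mk_hom B sum_structure inr.
  by rewrite inE orbC imset_f.
exists sum_structure, i1, i2 => Z f g.
pose h (x : A + B) := match x with inl a => val f a | inr b => val g b end.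
have [i t|u uE] := @mk_hom sum_structure Z h.
  rewrite inE => /orP[] /imsetP[s sA ->{t}].
    by apply: tuple_set_ext (hom_tuple f sA) => j; rewrite !tnth_map.
  by apply: tuple_set_ext (hom_tuple g sA) => j; rewrite !tnth_map.
exists u; split.
  by split; apply/hom_comp_ext => x; rewrite uE ?i1E ?i2E.
move=> v [/hom_comp_ext v1 /hom_comp_ext v2]; apply: hom_ext => x.
by rewrite uE; case: x => x; rewrite /= -?v1 -?v2 ?i1E ?i2E.
Qed.

End Coproduct.

(** * Limits and colimits of finite diagrams *)

Variables (J : finCategory) (D : functor J (STRUCT sigma)).

Let Dobj (j : fin_obj J) : structure sigma := D j.
Let Dmap (i j : fin_obj J) (f : fin_hom i j) : homomorphism (Dobj i) (Dobj j) :=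
  @fmap _ _ D i j f.

Definition compatible (x : {dffun forall j : fin_obj J, Dobj j}) : bool :=
  [forall i, forall j, forall f : fin_hom i j, val (Dmap f) (x i) == x j].

Definition lim_univ :=
  {x : {dffun forall j : fin_obj J, Dobj j} | compatible x}.

Definition lim_structure : structure sigma :=
  @Structure sigma lim_univ (fun i => [set t : (arity i).-tuple lim_univ |
    [forall j : fin_obj J,
       map_tuple (fun x : lim_univ => val x j) t \in interp (Dobj j) i]]).

Lemma STRUCT_limit :
  exists (L : STRUCT sigma) (p : forall j : J, hom L (D j)), is_limit p.
Proof.
have projP (j : fin_obj J) :
  {p : homomorphism lim_structure (Dobj j) | forall x, val p x = val x j}.
  by apply: mk_hom => i t; rewrite inE => /forallP.
exists lim_structure, (fun j : J => sval (projP j)).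
have pE j x : val (sval (projP j)) x = val x j by case: (projP j).
split.
  move=> i j f; apply/hom_comp_ext => x; rewrite !pE.
  have /forallP/(_ i)/forallP/(_ j)/forallP/(_ f)/eqP := valP x; exact.
move=> X q q_cone.
have compat_q x : compatible [ffun j : fin_obj J => val (q j) x].
  apply/forallP => i; apply/forallP => j; apply/forallP => f; apply/eqP.
  by rewrite !ffunE; move/hom_comp_ext: (q_cone i j f); apply.
pose h (x : (X : structure sigma)) : lim_structure :=
  exist (fun y => compatible y) _ (compat_q x).
have [i t tX|u uE] := @mk_hom X lim_structure h.
  rewrite inE; apply/forallP => j.
  by apply: tuple_set_ext (hom_tuple (q j) tX) => l; rewrite !tnth_map ffunE.
exists u; split.
  by move=> j; apply/hom_comp_ext => x; rewrite pE uE ffunE.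
move=> v vq; apply: hom_ext => x; rewrite uE; apply/val_inj/ffunP => j.
by rewrite ffunE; move/hom_comp_ext: (vq j) => <-; rewrite pE.
Qed.

(** The universe of the colimit is the disjoint union modulo the equivalence generated by this
    relation: the connected components of its symmetrization, each represented by its root, which
    keeps the quotient a finite type. *)
Definition glue_rel : rel {j : fin_obj J & Dobj j} :=
  [rel x y | [exists f : fin_hom (tag x) (tag y),
     val (Dmap f) (tagged x) == tagged y]].

Definition glue_sym_rel : rel {j : fin_obj J & Dobj j} :=
  relU glue_rel [rel x y | glue_rel y x].

Lemma glue_sym : connect_sym glue_sym_rel.
Proof. by apply: sym_connect_sym => x y; rewrite /glue_sym_rel /= orbC. Qed.

Definition glue_class := {x : {j : fin_obj J & Dobj j} | roots glue_sym_rel x}.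

Definition glue (x : {j : fin_obj J & Dobj j}) : glue_class :=
  exist (fun x => roots glue_sym_rel x) _ (roots_root glue_sym x).

Definition colim_structure : structure sigma :=
  @Structure sigma glue_class (fun i => \bigcup_(j : fin_obj J)
    [set map_tuple (fun x => glue (Tagged Dobj x)) t | t in interp (Dobj j) i]).

Lemma STRUCT_colimit :
  exists (L : STRUCT sigma) (p : forall j : J, hom (D j) L), is_colimit p.
Proof.
have injP (j : fin_obj J) : {p : homomorphism (Dobj j) colim_structure |
    forall x, val p x = glue (Tagged Dobj x)}.
  apply: mk_hom => i t tD.
  by apply/bigcupP; exists j => //; rewrite imset_f.
exists colim_structure, (fun j : J => sval (injP j)).
have pE j x : val (sval (injP j)) x = glue (Tagged Dobj x) by case: (injP j).
split.
  move=> i j f; apply/hom_comp_ext => x; rewrite !pE; apply/esym/val_inj/rootP.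
    exact: glue_sym.
  by apply: connect1; apply/orP; left; apply/existsP; exists f.
move=> X q q_cocone.
pose h (x : {j : fin_obj J & Dobj j}) : (X : structure sigma) :=
  val (q (tag x)) (tagged x).
have h_glue x y : glue_rel x y -> h x = h y.
  case/existsP=> f /eqP fx; rewrite /h -fx.
  by move/hom_comp_ext: (q_cocone _ _ f) => <-.
(* [h] is constant along every edge, hence along a path from [x] to its root. *)
have h_root x : h (root glue_sym_rel x) = h x.
  have /connectP[s] := connect_root glue_sym_rel x; move: (root _ x) => r.
  elim: s x => [|y s IHs] x /=; first by move=> _ ->.
  case/andP=> /orP xy /IHs rs /rs->.
  by case: xy => [/h_glue|/h_glue].
have [i t|u uE] := @mk_hom colim_structure X (fun x => h (val x)).
  case/bigcupP=> j _ /imsetP[s sD ->].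
  by apply: tuple_set_ext (hom_tuple (q j) sD) => l; rewrite !tnth_map h_root.
exists u; split.
  by move=> j; apply/hom_comp_ext => x; rewrite uE pE h_root.
move=> v vq; apply: hom_ext => -[[j x] rx]; rewrite uE /=.
have /hom_comp_ext/(_ x) := vq j; rewrite pE /h /= => <-; congr (val v _).
by apply: val_inj; apply/eqP.
Qed.

End FiniteLimits.

(** * Tree-depth and primitive-positive sentences *)

Lemma tree_depth_leqP (G : sgraph) k :
  tree_depth G <= k <->
  exists2 F : rforest, height F <= k & closure_contains F G.
Proof.
rewrite /tree_depth; case: ex_minnP => m /asboolP[F [hF FG]] min_m.
split=> [le_mk|[F' le_F'k F'G]]; first by exists F; rewrite ?hF.
apply: leq_trans le_F'k; apply/min_m/asboolP; by exists F'.
Qed.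

(** * Branches of a rooted forest *)

Section Branches.
Variable F : rforest.

Let up := parent_rel (@parent F).

(** [parent] is a function, so two upward paths from [x] could only differ by one continuing past a
    root. *)
Lemma root_path_uniq x p q :
  path up x p -> path up x q -> parent (last x p) = None ->
  parent (last x q) = None -> p = q.
Proof.
elim: p x q => [|y p IHp] x [|z q] //=.
- by move=> _ /andP[/eqP-> _].
- by move=> /andP[/eqP-> _].
move=> /andP[/eqP xy yp] /andP[/eqP]; rewrite xy => -[<-] yq rp rq.
by congr (_ :: _); apply: IHp rp rq.
Qed.

(** [br x] is the path from [x] up to its root. It is a suffix of the branch of some leaf, whose
    nodes are distinct and counted by the height. *)
Lemma forest_branches :
  exists br : F -> seq F,
    [/\ forall x, exists p, br x = x :: p,
        forall x y, ancestor_or_self y x -> suffix (br y) (br x)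
      & forall x, size (br x) <= height F].
Proof.
have ex_p x : exists p, path up x p /\ parent (last x p) = None.
  by have [r /connectP[p xp ->] pr] := rooted x; exists p.
have [pr prP] := choice ex_p; pose br x := x :: pr x.
have brS x y : up x y -> br x = x :: br y.
  move=> xy; congr (_ :: _); have [? ?] := prP x; have [? ?] := prP y.
  by apply: (@root_path_uniq x) => //=; apply/andP.
have anc_suffix x y : ancestor_or_self y x -> suffix (br y) (br x).
  case/connectP=> p; elim: p x => [|z p IHp] x /=.
    by move=> _ ->; apply: suffix_refl.
  case/andP=> xz zp yp; apply: suffix_trans (IHp z zp yp) _.
  by rewrite (brS x z xz) suffix_cons.
have br_anc x : {subset br x <= [set y | ancestor_or_self y x]}.
  by move=> y; have [xp _] := prP x => /(path_connect xp); rewrite inE.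
have br_uniq x : uniq (br x).
  have uniq_path p z : path up z p -> pr z = p -> uniq (z :: p).
    elim: p z => [|y p IHp] z //= /andP[zy yp] prz.
    have pry : pr y = p by have := brS _ _ zy; rewrite /br prz => -[].
    rewrite -[_ && uniq p]/(uniq (y :: p)) (IHp y yp pry) andbT.
    (* If [z] recurred above itself, its branch would be a suffix of the shorter branch of its
       parent [y]. *)
    apply/negP => zyp; have : suffix (br z) (br y).
      by apply: anc_suffix; apply: (path_connect yp).
    by move/size_suffix; rewrite (brS _ _ zy) /= ltnn.
  by have [xp _] := prP x; apply: uniq_path.
exists br; split=> // [x|x]; first by exists (pr x).
(* [height] only looks at leaves: a longest branch extending that of [x] must start at one. *)
have [w xw max_w] := 
  @arg_maxnP _ x (fun w => suffix (br x) (br w)) (fun w => size (br w))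
    (suffix_refl (br x)).
apply: leq_trans (size_suffix xw) _.
have leaf_w : leaf w.
  apply/forallP => y; apply/negP => yw.
  have /max_w : suffix (br x) (br y).
    by apply: suffix_trans xw _; rewrite (brS y w yw) suffix_cons.
  by rewrite (brS y w yw) /= ltnn.
apply: leq_trans (leq_bigmax_cond _ leaf_w).
by rewrite -(card_uniqP (br_uniq w)) subset_leq_card //; apply/subsetP/br_anc.
Qed.

End Branches.

(** * The unravelling of a structure into plays *)

Section Unravelling.
Variables (sigma : vocabulary) (k : nat) (A : structure sigma).

(* A play is a stack of at most [k] moves, the most recent one first. *)
Definition play := {s : k.-bseq A | 0 < size s}.

Implicit Types u v : play.

Definition stack u : seq A := val (val u).

(** The proof that the stack is nonempty serves as the bound for index 0, avoiding a default in a
    possibly empty [A]. *)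
Definition top u : A := tnth (in_tuple (stack u)) (Ordinal (valP u)).

Lemma stack_inj : injective stack.
Proof. exact: inj_comp val_inj val_inj. Qed.

Lemma size_stack u : 0 < size (stack u) <= k.
Proof. by rewrite (valP u) size_bseq. Qed.

Lemma play_of (s : seq A) : 0 < size s <= k -> exists u, stack u = s.
Proof.
case/andP=> s_gt0 le_sk; pose b : k.-bseq A := Bseq le_sk.
by exists (exist (fun s : k.-bseq A => 0 < size s) b s_gt0).
Qed.

Lemma stackE u : stack u = top u :: behead (stack u).
Proof.
rewrite /top (tnth_nth (top u)) /=.
by have := size_stack u; case: (stack u).
Qed.

Lemma top_drop u (s : seq A) (j : 'I_(size s)) :
  stack u = drop j s -> top u = tnth (in_tuple s) j.
Proof. by rewrite (drop_nth (top u)) // stackE (tnth_nth (top u)) => -[]. Qed.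

Lemma top_drop_index u (s : seq A) a :
  stack u = drop (index a s) s -> top u = a /\ a \in s.
Proof.
have [a_s|] := boolP (a \in s).
  by rewrite (drop_nth a) ?index_mem // nth_index // stackE => -[].
by rewrite -index_mem -leqNgt => /drop_oversize->; rewrite stackE.
Qed.

Definition comparable u v : bool :=
  suffix (stack u) (stack v) || suffix (stack v) (stack u).

Definition unravel : structure sigma :=
  @Structure sigma play (fun i => [set t : (arity i).-tuple play |
    (map_tuple top t \in interp A i) && all2rel comparable t]).

Lemma unravel_top : inhabited (homomorphism unravel A).
Proof.
have [i t|h _] := @mk_hom sigma unravel A top; last by exists.
by rewrite inE => /andP[].
Qed.

(** The outer [insub] fails exactly on one-move plays, the roots; the inner insertion never meets
    its default, the tail being short enough. *)
Definition play_parent u : option play :=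
  insub (insub_bseq k (behead (stack u))).

Lemma play_parentE u v :
  parent_rel play_parent u v = (stack v == behead (stack u)).
Proof.
have bE : insub_bseq k (behead (stack u)) = behead (stack u) :> seq A.
  rewrite /insub_bseq val_insubd size_behead ifT //.
  by case/andP: (size_stack u) => _; apply/leq_trans/leq_pred.
rewrite /parent_rel /play_parent; case: insubP => [w _ wE|].
  have <- : stack w = behead (stack u) by rewrite -bE -wE.
  by rewrite (inj_eq (@Some_inj _)) eq_sym (inj_eq stack_inj).
rewrite bE -leqNgt leqn0 => /nilP->; case/andP: (size_stack v).
by case: (stack v).
Qed.

Lemma play_ancestor u v :
  connect (parent_rel play_parent) u v = suffix (stack v) (stack u).
Proof.
apply/idP/idP => [/connectP[p]|].
  elim: p u => [|w p IHp] u /=; first by move=> _ ->; apply: suffix_refl.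
  case/andP; rewrite play_parentE => /eqP wE wp /(IHp _ wp) vw.
  by apply: suffix_trans vw _; rewrite wE -drop1 suffix_drop.
case/suffixP=> s; elim: s u => [|a s IHs] u uE.
  by rewrite (stack_inj uE) connect0.
have [|w wE] := @play_of (s ++ stack v).
  have [/andP[v_gt0 _] /andP[_]] := (size_stack v, size_stack u).
  by rewrite uE /= !size_cat addn_gt0 v_gt0 orbT; apply: ltnW.
apply: connect_trans (IHs w wE); apply: connect1.
by rewrite play_parentE wE uE.
Qed.

Lemma play_rooted u : exists2 r, connect (parent_rel play_parent) u r
                               & play_parent r = None.
Proof.
have [n] := ubnP (size (stack u)); elim: n u => // n IHn u lt_un.
case E: (play_parent u) => [v|]; last by exists u; rewrite ?connect0.
have uv : parent_rel play_parent u v by apply/eqP.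
have [|r vr rP] := IHn v.
  move: (uv); rewrite play_parentE => /eqP->; rewrite size_behead.
  by rewrite prednK //; case/andP: (size_stack u).
by exists r => //; apply: connect_trans vr; apply: connect1.
Qed.

Definition play_forest : rforest := RForest play_rooted.

(** The ancestors of a play are suffixes of one stack, hence determined by their sizes in [1..k],
    shifted down by one to index ['I_k]. *)
Lemma play_forest_height : height play_forest <= k.
Proof.
apply/bigmax_leqP => u _.
have sizeK v : (size (stack v)).-1.+1 = size (stack v).
  by case/andP: (size_stack v) => v_gt0 _; rewrite prednK.
have size_lt v : (size (stack v)).-1 < k.
  by rewrite sizeK; case/andP: (size_stack v).
rewrite -[X in _ <= X]card_ord.
rewrite -(@card_in_imset _ _ (fun v => Ordinal (size_lt v))); first exact: max_card.
move=> v w; rewrite !inE /ancestor_or_self !play_ancestor.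
rewrite !suffixE => /eqP vE /eqP wE [] /(congr1 succn).
by rewrite !sizeK => vw; apply: stack_inj; rewrite -vE -wE vw.
Qed.

Lemma unravel_tree_depth : structure_tree_depth unravel <= k.
Proof.
apply/tree_depth_leqP; exists play_forest; first exact: play_forest_height.
exists id; split=> // u v /andP[neq_uv /existsP[i /exists_inP[t]]].
rewrite inE => /andP[_ /allrelP comp] /andP[ut vt].
have := comp u v ut vt; rewrite /closure_adj /ancestor /ancestor_or_self.
by rewrite !play_ancestor neq_uv eq_sym neq_uv.
Qed.

(** Send [x] to the play listing the [c]-images along the branch of [f x]; elements sharing a tuple
    lie on a common branch, so their plays are comparable. *)
Lemma unravel_lift (C : structure sigma) :
  structure_tree_depth C <= k -> homomorphism C A ->
  inhabited (homomorphism C unravel).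
Proof.
case/tree_depth_leqP=> F le_Fk [f [f_inj f_adj]] c.
have [br [br_head br_suffix br_size]] := forest_branches F.
(* A partial inverse of [f]: forest nodes outside its image are dropped from the branches by
   [pmap]. *)
pose finv y := [pick x | f x == y].
have fK x : finv (f x) = Some x.
  by rewrite /finv; case: pickP => [y /eqP/f_inj->|/(_ x)/eqP].
pose stk x := map (val c) (pmap finv (br (f x))).
have stk_head x : exists s, stk x = val c x :: s.
  have [p xp] := br_head (f x); exists (map (val c) (pmap finv p)).
  by rewrite /stk xp /= fK.
have ex_u x : exists u, stack u = stk x.
  apply: play_of; have [s sE] := stk_head x; rewrite {1}sE /=.
  rewrite size_map size_pmap (leq_trans (count_size _ _)) //.
  exact: leq_trans (br_size _) le_Fk.
have [u uE] := choice ex_u.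
have top_u x : top (u x) = val c x.
  by have [s sE] := stk_head x; have := uE x; rewrite sE stackE => -[].
have stk_suffix x y :
    ancestor_or_self (f x) (f y) -> suffix (stack (u x)) (stack (u y)).
  move=> /br_suffix /suffixP[s sE].
  by rewrite !uE /stk sE pmap_cat map_cat suffix_suffix.
have [i t tC|h _] := @mk_hom sigma C unravel u; last by exists.
rewrite inE; apply/andP; split.
  by apply: tuple_set_ext (hom_tuple c tC) => j; rewrite !tnth_map top_u.
apply/allrelP => _ _ /mapP[x xt ->] /mapP[y yt ->].
have [->|neq_xy] := eqVneq x y; first by rewrite /comparable suffix_refl.
have /f_adj : gaifman_adj x y.
  rewrite /gaifman_adj neq_xy; apply/existsP; exists i.
  by apply/exists_inP; exists t => //; rewrite xt.
by case/orP=> /andP[_ /stk_suffix xy]; rewrite /comparable xy ?orbT.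
Qed.

(** Invariant: [s] is the current play, each value of [e] occurs in it, and [e'] holds the
    [h]-images of the plays ending at those occurrences. The rank bound leaves room for the
    remaining moves. *)
Lemma unravel_hom_sat (B : structure sigma) (h : homomorphism unravel B)
    n (phi : ppform sigma n) (s : seq A) (e : n.-tuple A) (e' : n.-tuple B) :
  size s + qrank phi <= k ->
  (forall x : 'I_n, exists u, stack u = drop (index (tnth e x) s) s /\
                              tnth e' x = val h u) ->
  sat phi e -> sat phi e'.
Proof.
elim: phi s e e' => {n} [n|n x y|n i xs|n phi IHphi psi IHpsi|n phi IHphi]
  s e e' //=.
- move=> _ ee' exy; have [u [uE ->]] := ee' x; have [v [vE ->]] := ee' y.
  by congr (val h _); apply: stack_inj; rewrite uE vE exy.
- move=> _ ee'; have [u uP] := choice ee' => xsA.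
  have tU : map_tuple u xs \in interp unravel i.
    rewrite inE; apply/andP; split.
      apply: tuple_set_ext xsA => j; rewrite !tnth_map.
      by have [uE _] := uP (tnth xs j); have [-> _] := top_drop_index uE.
    apply/allrelP => _ _ /mapP[x _ ->] /mapP[y _ ->]; rewrite /comparable.
    have [-> _] := uP x; have [-> _] := uP y.
    have drop_suffix m l : m <= l -> suffix (drop l s) (drop m s).
      by move=> /subnK <-; rewrite -drop_drop suffix_drop.
    by apply/orP; case: (leqP (index (tnth e x) s) (index (tnth e y) s));
      [right | move/ltnW; left]; apply: drop_suffix.
  apply: tuple_set_ext (hom_tuple h tU) => j; rewrite !tnth_map.
  by have [_ ->] := uP (tnth xs j).
- rewrite addn_maxr geq_max => /andP[le_phi le_psi] ee' [phi_e psi_e].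
  by split; [apply: IHphi phi_e | apply: IHpsi psi_e]; eassumption.
rewrite addnS => le_k ee' [a phi_ae].
(* Reuse the existing position when [a] was already played, so that equal
   values are always answered by equal values. *)
have [a_s|a_s] := boolP (a \in s).
  have [|u uE] := @play_of (drop (index a s) s).
    rewrite size_drop subn_gt0 index_mem a_s (leq_trans (leq_subr _ _)) //.
    by apply: leq_trans (ltnW le_k); apply: leq_addr.
  exists (val h u); apply: (IHphi s) phi_ae; first exact: ltnW.
  move=> x; have [y ->|->] := unliftP ord0 x; last by exists u; rewrite !tnth0.
  by have [v vP] := ee' y; exists v; rewrite !tnthS.
rewrite -addSn in le_k.
have [|u uE] := @play_of (a :: s); first exact: leq_trans (leq_addr _ _) le_k.
exists (val h u); apply: (IHphi (a :: s)) phi_ae => // x.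
have [y ->|->] := unliftP ord0 x.
  have [v [vE vP]] := ee' y; exists v; rewrite !tnthS vP vE /=; split=> //.
  (* An old value differs from the new [a], so its index grows by one and the stack dropped to it is
     unchanged. *)
  have [_ ys] := top_drop_index vE.
  by rewrite ifN //; apply: contraNneq a_s => ->.
by exists u; rewrite !tnth0 /= eqxx.
Qed.

End Unravelling.

(** * Characteristic formulas and Duplicator's replies *)

Section CharacteristicFormulas.
Variables (sigma : vocabulary) (A : structure sigma).

Definition bigand n (I : Type) (s : seq I) (F : I -> ppform sigma n) :
  ppform sigma n := foldr (fun i phi => PPAnd (F i) phi) (@PPTrue sigma n) s.

Lemma sat_bigand (B : structure sigma) n (I : eqType) (s : seq I)
    (F : I -> ppform sigma n) (e : n.-tuple B) :
  sat (bigand s F) e <-> (forall i, i \in s -> sat (F i) e).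
Proof.
elim: s => [|j s IHs] /=; first by split.
split=> [[satj /IHs sats] i|sat_all].
  by rewrite inE => /predU1P[->|/sats].
split; first by apply: sat_all; rewrite mem_head.
by apply/IHs => i i_s; apply: sat_all; rewrite inE i_s orbT.
Qed.

Lemma qrank_bigand n (I : Type) (s : seq I) (F : I -> ppform sigma n) r :
  (forall i, qrank (F i) <= r) -> qrank (bigand s F) <= r.
Proof. by move=> Fr; elim: s => //= i s IHs; rewrite geq_max Fr. Qed.

(** Only relational atoms are listed: equal values at different positions of a play may receive
    different replies. *)
Definition true_atoms n (e : n.-tuple A) : ppform sigma n :=
  bigand [seq p <- enum {: {i : 'I_(nsym sigma) & (arity i).-tuple 'I_n}} |
            map_tuple (tnth e) (tagged p) \in interp A (tag p)]
    (fun p => PPRel (tagged p)).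

(** Says that Duplicator survives [r] more rounds of the existential-positive game from position
    [e]. *)
Fixpoint charform r n (e : n.-tuple A) : ppform sigma n :=
  PPAnd (true_atoms e)
    (if r is r'.+1
     then bigand (enum A) (fun a => PPEx (charform r' (cons_tuple a e)))
     else @PPTrue sigma n).

Lemma charform_qrank r n (e : n.-tuple A) : qrank (charform r e) <= r.
Proof.
elim: r n e => [|r IHr] n e /=; rewrite geq_max.
  by rewrite andbT qrank_bigand.
by rewrite !qrank_bigand // => a; rewrite /= ltnS.
Qed.

Lemma charform_self r n (e : n.-tuple A) : sat (charform r e) e.
Proof.
elim: r n e => [|r IHr] n e /=; split=> //;
  try by apply/sat_bigand => p; rewrite mem_filter => /andP[].
by apply/sat_bigand => a _; exists a.
Qed.

Lemma charform_atom (B : structure sigma) r n (e : n.-tuple A) (e' : n.-tuple B)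
    i (xs : (arity i).-tuple 'I_n) :
  sat (charform r e) e' -> map_tuple (tnth e) xs \in interp A i ->
  map_tuple (tnth e') xs \in interp B i.
Proof.
case: r => [|r] /= [/sat_bigand atoms _] xsA;
  by apply: (atoms (Tagged (fun i => (arity i).-tuple 'I_n) xs));
    rewrite mem_filter xsA mem_enum.
Qed.

Lemma charform_step (B : structure sigma) r n (e : n.-tuple A) (e' : n.-tuple B)
    a :
  sat (charform r.+1 e) e' ->
  exists b, sat (charform r (cons_tuple a e)) (cons_tuple b e').
Proof. by case=> _ /sat_bigand/(_ a); apply; rewrite mem_enum. Qed.

Section Answers.
Variables (B : structure sigma) (k : nat).
Hypothesis B_char : sat (charform k (nil_tuple A)) (nil_tuple B).

(** One quantifier pays for the reply to the newest move, [thead e]. *)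
Lemma answer_ex n (e : n.+1.-tuple A) (e' : n.-tuple B) : n < k ->
  sat (charform (k - n) (behead_tuple e)) e' ->
  exists b, sat (charform (k - n.+1) e) (cons_tuple b e').
Proof.
move=> lt_nk; rewrite -(subnSK lt_nk) => /(charform_step (thead e)).
by rewrite -[cons_tuple (thead e) _]tuple_eta.
Qed.

(** Replies are chosen by recursion on the play, so each depends only on its move and the earlier
    ones. The definition is transparent because [answers_drop] unfolds it. *)
Definition answers n : n <= k -> forall e : n.-tuple A,
  {e' : n.-tuple B | sat (charform (k - n) e) e'}.
Proof.
elim: n => [|n IHn] le_nk e.
  by exists (nil_tuple B); rewrite subn0 tuple0.
pose e' := IHn (ltnW le_nk) (behead_tuple e).
exists (cons_tuple (sval (boolp.cid (answer_ex le_nk (svalP e')))) (sval e')).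
exact: svalP (boolp.cid (answer_ex le_nk (svalP e'))).
Defined.

Lemma answers_drop (s : seq A) (le_sk : size s <= k) m
    (le_dk : size (drop m s) <= k) :
  sval (answers le_dk (in_tuple (drop m s))) =
  drop m (sval (answers le_sk (in_tuple s))) :> seq B.
Proof.
elim: m s le_sk le_dk => [|m IHm] s le_sk.
  by rewrite drop0 => le_dk; rewrite (bool_irrelevance le_dk le_sk) drop0.
case: s le_sk => [|a s] le_sk le_dk; first by [].
rewrite (IHm s (ltnW le_sk)) /=; congr (drop m (sval (answers _ _))).
exact: val_inj.
Qed.

Definition play_answer (u : play k A) : B :=
  tnth (sval (answers (size_bseq (val u)) (in_tuple (stack u)))) (Ordinal (valP u)).

(** Lets the replies to several comparable plays be read off one play [s] extending them all. *)
Lemma play_answer_drop u (s : seq A) (le_sk : size s <= k) (j : 'I_(size s)) :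
  stack u = drop j s ->
  play_answer u = tnth (sval (answers le_sk (in_tuple s))) j.
Proof.
move=> uE; pose b := play_answer u; rewrite /play_answer !(tnth_nth b) /=.
move: (size_bseq (val u)); rewrite -[bseqval _]/(stack u) uE => le_dk.
by rewrite answers_drop nth_drop addn0.
Qed.

Lemma comparable_plays (ts : seq (play k A)) : all2rel (@comparable _ k A) ts ->
  exists2 s : seq A, size s <= k & {in ts, forall u, suffix (stack u) s}.
Proof.
move=> /allrelP comp.
(* For the induction, [s] is moreover empty or one of the listed stacks, hence comparable with the
   next play. *)
suff [s [le_sk sub_s _]] : exists s : seq A, [/\ size s <= k,
    {in ts, forall u, suffix (stack u) s} &
    s = [::] \/ exists2 u, u \in ts & s = stack u] by exists s.
elim: ts comp => [|u ts IHts] comp; first by exists [::]; split=> //; left.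
have [|s [le_sk sub_s s_ts]] := IHts.
  by move=> v w v_ts w_ts; apply: comp; rewrite inE ?v_ts ?w_ts orbT.
have [us|su] : suffix (stack u) s \/ suffix s (stack u).
- case: s_ts => [->|[v v_ts ->]]; first by right; apply: suffix0s.
  by apply/orP; apply: comp; rewrite inE ?eqxx ?v_ts ?orbT.
- exists s; split=> //; first by move=> v; rewrite inE => /predU1P[->|/sub_s].
  by case: s_ts => [|[v v_ts sE]]; [left | right; exists v; rewrite // inE v_ts orbT].
exists (stack u); split; first by case/andP: (size_stack u).
  move=> v; rewrite inE => /predU1P[->|/sub_s vs]; first exact: suffix_refl.
  exact: suffix_trans vs su.
by right; exists u; rewrite // mem_head.
Qed.

(** Related plays are positions in one play [s], so their tuple is a true atom about [s], and the
    replies to [s] satisfy it. *)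
Lemma charform_hom : inhabited (homomorphism (unravel k A) B).
Proof.
have [i t|h _] := @mk_hom sigma (unravel k A) B play_answer; last by exists.
rewrite inE => /andP[tA /comparable_plays[s le_sk t_s]].
have ex_j l : exists j : 'I_(size s), stack (tnth t l) = drop j s.
  have := t_s _ (mem_tnth l t); rewrite suffixE => /eqP sE.
  have /andP[u_gt0 _] := size_stack (tnth t l).
  have s_gt0 : 0 < size s.
    by apply: leq_trans u_gt0 _; rewrite -sE size_drop leq_subr.
  have lt_s : size s - size (stack (tnth t l)) < size s by rewrite ltn_subrL u_gt0.
  by exists (Ordinal lt_s).
(* The variable [j l] names the position in [s] where the [l]-th play ends. *)
have [j jE] := choice ex_j; pose xs := mktuple j.
have xsA : map_tuple (tnth (in_tuple s)) xs \in interp A i.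
  apply: tuple_set_ext tA => l.
  by rewrite !tnth_map tnth_ord_tuple (top_drop (jE l)).
apply: tuple_set_ext (charform_atom (svalP (answers le_sk (in_tuple s))) xsA) => l.
by rewrite !tnth_map tnth_ord_tuple -(play_answer_drop le_sk (jE l)).
Qed.

End Answers.

End CharacteristicFormulas.

(** Both sides amount to a homomorphism from [unravel k A] to [B]. *)
Lemma k_homomorphicP (sigma : vocabulary) k (A B : structure sigma) :
  k_homomorphic k A B <->
  (forall phi : ppsentence sigma, qrank phi <= k -> models A phi -> models B phi).
Proof.
split=> [kAB phi le_phi|ppAB C td_C [c]].
  have [h] := kAB _ (unravel_tree_depth k A) (unravel_top k A).
  by apply: (@unravel_hom_sat _ _ _ _ h _ _ [::] (nil_tuple A)) => // -[].
have [u] := unravel_lift td_C c.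
have /charform_hom[h] : models B (charform k (nil_tuple A)).
  by apply: ppAB; [apply: charform_qrank | apply: charform_self].
by exists; apply: hom_comp h u.
Qed.

Theorem theorem2 (sigma : vocabulary) :
  exists M : model_structure (STRUCT sigma),
    (forall (A B : STRUCT sigma) (f : hom A B),
       homotopy_equivalence M f <-> homomorphic_equivalence f) /\
    (forall (k : nat) (A B : structure sigma),
       k_homotopy_equivalent k A B <->
       (forall phi : ppsentence sigma, qrank phi <= k ->
          (models A phi <-> models B phi))).
Proof.
exists (preorder_model (@STRUCT_limit sigma) (@STRUCT_colimit sigma)
  (@STRUCT_product sigma) (@STRUCT_coproduct sigma)).
split=> [A B f|k A B]; first exact: preorder_homotopy_equivalence.
rewrite /k_homotopy_equivalent !k_homomorphicP.
split=> [[AB BA] phi le_phi|AB]; first by split; [apply: AB | apply: BA].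
by split=> phi /AB[].
Qed.
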